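(* Let $P\subseteq\mathbb{R}^d$ be a finite set of $n$ points, let $k$ be an integer with $1\le k\le n$, and let $\epsilon\in(0,1]$. Let $\mathcal{D}=\{D_r\}_{r\ge 0}$ be the discrete sparse $k$th order Čech filtration of $P$ with parameter $\epsilon$ (defined in the context). Then $\mathcal{D}$ is $(1+\epsilon)$-homotopy-interleaved with the $k$-fold filtration $\mathcal{L}=\{L_r\}_{r\ge 0}$ of $P$.
   Context: **k-fold filtration.** $B_r(a)$ is the closed Euclidean ball of radius $r$ centered at $a$. $\binom{P}{k}$ is the collection of $k$-element subsets of $P$. For $A\in\binom{P}{k}$ and $r\ge0$, the lens is $L_r(A)=\bigcap_{a\in A}B_r(a)$. The $k$-fold cover is $L_r=\bigcup_{A\in\binom{P}{k}}L_r(A)$, and $\mathcal{L}=\{L_r\}_{r\ge0}$ is the $k$-fold filtration. **k-distance permutation.** For a finite set $Q$ with $|Q|\ge k$, $\operatorname{d}^k(x,Q)$ is the distance from $x$ to its $k$th closest point in $Q$. The $k$-distance permutation is an ordering $p_1,\dots,p_n$ of $P$, with $P_i=\{p_1,\dots,p_i\}$, in which $p_1,\dots,p_k$ are arbitrary distinct points of $P$ and, for $k<i\le n$, $p_i\in\operatorname{argmax}_{q\in P\setminus P_{i-1}}\operatorname{d}^k(q,P_{i-1})$. Set $\lambda_1=\dots=\lambda_k=\infty$ and $\lambda_i=\operatorname{d}^k(p_i,P_{i-1})$ for $i>k$. **Freezing lenses, with parameter $\epsilon'=\epsilon/3$.** Put $\operatorname{frz}(p_i)=\frac{(1+\epsilon')\lambda_i}{\epsilon'}$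 and $\operatorname{frz}(A)=\min_{p\in A}\operatorname{frz}(p)$. Define $\widetilde L_r(A)=L_r(A)$ if $r<\operatorname{frz}(A)$; $\widetilde L_r(A)=L_{\operatorname{frz}(A)}(A)$ if $\operatorname{frz}(A)\le r\le(1+\epsilon')\operatorname{frz}(A)$; $\widetilde L_r(A)=\emptyset$ if $r>(1+\epsilon')\operatorname{frz}(A)$. **Sparse complexes.** The cone is $C_r(A)=\bigcup_{\alpha\in[0,r]}\widetilde L_\alpha(A)\times\{\alpha\}\subseteq\mathbb{R}^d\times\mathbb{R}$. The sparse $k$th order Čech complex $S_r$ is the nerve of the family $\{C_r(A)\}_{A\in\binom{P}{k}}$: the simplicial complex whose simplices are the non-empty sets $\{A_1,\dots,A_m\}\subseteq\binom{P}{k}$ with $\bigcap_j C_r(A_j)\neq\emptyset$. For $r>0$, let $z\in\mathbb{Z}$ be such that $(1+\epsilon/3)^z\le r<(1+\epsilon/3)^{z+1}$ and set $D_r=S_{(1+\epsilon/3)^z}$; set $D_0=S_0$. $\mathcal{D}=\{D_r\}_{r\ge0}$ is the discrete sparse $k$th order Čech filtration. Simplicial complexes are regarded as topological spaces via geometric realization. **Filtrations and interleavings.** A filtration is a family $\{X_r\}_{r\ge0}$ of topological spaces with $X_r\subseteq X_{r'}$ for $r\le r'$. Two filtrations $\mathcal{X},\mathcal{Y}$ are equivalent if there is a family of homotopy equivalences $X_r\to Y_r$ ($r\ge 0$) commuting with the inclusion maps of $\mathcal X$ and $\mathcal Y$ (the notion is used symmetrically: the family may go from $\mathcal X$ to $\mathcal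 Y$ or from $\mathcal Y$ to $\mathcal X$). For $c\ge 1$, $\mathcal{X},\mathcal{Y}$ are $c$-interleaved if there are maps $f_r:X_r\to Y_{cr}$, $g_r:Y_r\to X_{cr}$ ($r\ge 0$) such that $g_{cr}\circ f_r$ and $f_{cr}\circ g_r$ are the inclusions $X_r\hookrightarrow X_{c^2r}$ and $Y_r\hookrightarrow Y_{c^2r}$ for all $r$; in particular this holds with inclusion maps if $X_r\subseteq Y_r\subseteq X_{cr}$ for all $r$. $\mathcal{X},\mathcal{Y}$ are $c$-homotopy-interleaved if there are filtrations $\mathcal{X}'$ equivalent to $\mathcal{X}$ and $\mathcal{Y}'$ equivalent to $\mathcal{Y}$ such that $\mathcal{X}',\mathcal{Y}'$ are $c$-interleaved. *)

(* Defs.v *)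
From HB Require Import structures.
From mathcomp Require Import all_boot all_order all_algebra finmap.
From mathcomp Require Import all_classical all_reals all_analysis.

Set Implicit Arguments.
Unset Strict Implicit.
Unset Printing Implicit Defensive.

Import Order.TTheory GRing.Theory Num.Theory.
Import numFieldNormedType.Exports.

Local Open Scope classical_set_scope.
Local Open Scope ring_scope.

Definition embedding (X Y : topologicalType) (f : X -> Y) : Prop :=
  injective f /\
  forall U : set X, open U <-> exists2 V : set Y, open V & U = f @^-1` V.

(** A nested family of topological spaces [X_r], [r >= 0]: the relation
    [X_r ⊆ X_s] (as a subspace) is carried by the map [incl], and the last two
    fields say that these maps are compatible, as inclusions are. The values of
    [space] at negative reals play no role anywhere. *)
Record filtration (R : realType) := Filtration {
  space :> R -> topologicalType;
  incl : forall r s : R, 0 <= r <= s -> space r -> space s;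
  incl_embedding : forall (r s : R) (rs : 0 <= r <= s), embedding (incl rs);
  incl_id : forall (r : R) (rr : 0 <= r <= r) (x : space r), incl rr x = x;
  incl_comp : forall (r s t : R) (rs : 0 <= r <= s) (st : 0 <= s <= t)
    (rt : 0 <= r <= t) (x : space r), incl st (incl rs x) = incl rt x
}.

Definition homotopic (R : realType) (X Y : topologicalType) (f g : X -> Y) :
    Prop :=
  exists H : X * R -> Y,
    [/\ {within [set: X] `*` `[0, 1], continuous H},
        forall x, H (x, 0) = f x & forall x, H (x, 1) = g x].

Definition homotopy_equivalence (R : realType) (X Y : topologicalType)
    (f : X -> Y) : Prop :=
  continuous f /\
  exists g : Y -> X,
    [/\ continuous g, homotopic R (g \o f) idfun & homotopic R (f \o g) idfun].

Section interleavings.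
Variable R : realType.
Implicit Types (X Y : filtration R) (c : R).

Definition directed_equivalence X Y : Prop :=
  exists f : forall r : R, 0 <= r -> X r -> Y r,
    (forall (r : R) (r0 : 0 <= r), homotopy_equivalence R (f r r0)) /\
    (forall (r s : R) (rs : 0 <= r <= s) (r0 : 0 <= r) (s0 : 0 <= s) (x : X r),
       f s s0 (incl rs x) = incl rs (f r r0 x)).

Definition equivalent X Y : Prop :=
  directed_equivalence X Y \/ directed_equivalence Y X.

(** Since [1 <= c], the hypotheses [cr0] and [rccr] below always hold; [X_{c^2r}]
    is written [X (c * (c * r))]. *)
Definition interleaved c X Y : Prop :=
  1 <= c /\
  exists (f : forall r : R, 0 <= r -> X r -> Y (c * r))
         (g : forall r : R, 0 <= r -> Y r -> X (c * r)),
    [/\ forall (r : R) (r0 : 0 <= r), continuous (f r r0),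
        forall (r : R) (r0 : 0 <= r), continuous (g r r0),
        forall (r : R) (r0 : 0 <= r) (cr0 : 0 <= c * r)
          (rccr : 0 <= r <= c * (c * r)) (x : X r),
          g (c * r) cr0 (f r r0 x) = incl rccr x &
        forall (r : R) (r0 : 0 <= r) (cr0 : 0 <= c * r)
          (rccr : 0 <= r <= c * (c * r)) (y : Y r),
          f (c * r) cr0 (g r r0 y) = incl rccr y].

Definition homotopy_interleaved c X Y : Prop :=
  exists X' Y' : filtration R,
    [/\ equivalent X' X, equivalent Y' Y & interleaved c X' Y'].

End interleavings.

Section subspace_filtration.
Variables (R : realType) (T : topologicalType) (X : R -> set T).
Hypothesis X_mono : forall r s : R, 0 <= r <= s -> X r `<=` X s.

Definition subspace_incl (r s : R) (rs : 0 <= r <= s) (x : X r) : X s :=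
  exist _ (\val x) (mem_set (X_mono rs (set_mem (valP x)))).

Lemma subspace_incl_embedding (r s : R) (rs : 0 <= r <= s) :
  embedding (subspace_incl rs).
Proof.
split=> [x y /(congr1 val) /= xy|U]; first exact: val_inj.
split=> [[V oV <-]|[V [W oW <-] ->]]; last by exists W.
by exists (set_val @^-1` V) => //; exists V.
Qed.

Lemma subspace_incl_id (r : R) (rr : 0 <= r <= r) (x : X r) :
  subspace_incl rr x = x.
Proof. exact: val_inj. Qed.

Lemma subspace_incl_comp (r s t : R) (rs : 0 <= r <= s) (st : 0 <= s <= t)
    (rt : 0 <= r <= t) (x : X r) :
  subspace_incl st (subspace_incl rs x) = subspace_incl rt x.
Proof. exact: val_inj. Qed.

Definition subspace_filtration : filtration R :=
  @Filtration R (fun r => X r : topologicalType) subspace_incl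
    subspace_incl_embedding subspace_incl_id subspace_incl_comp.

End subspace_filtration.

Record scomplex (V : finType) := SComplex {
  simplex : set {set V};
  simplex_neq0 : forall s : {set V}, simplex s -> s != finset.set0;
  simplex_sub : forall s t : {set V}, simplex s -> t \subset s ->
    t != finset.set0 -> simplex t
}.

(** Barycentric coordinates; as the vertex set is finite, the topology of the
    realization is the one induced by the product topology of [R^V]. *)
Definition realization (R : realType) (V : finType) (K : scomplex V) :
    set {ptws V -> R} :=
  [set t : {ptws V -> R} | [/\ forall v, 0 <= t v, \sum_v t v = 1 &
     simplex K (finset.finset (fun v => t v != 0))]].

Arguments realization R {V} K.

Section nerve.
Variables (I : finType) (T : Type) (U : I -> set T).

Definition nerve_simplex : set {set I} :=
  [set s : {set I} | s != finset.set0 /\ (\bigcap_(i in [set` s]) U i) !=set0].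

Lemma nerve_simplex_neq0 (s : {set I}) : nerve_simplex s -> s != finset.set0.
Proof. by case. Qed.

Lemma nerve_simplex_sub (s t : {set I}) : nerve_simplex s -> t \subset s ->
  t != finset.set0 -> nerve_simplex t.
Proof.
move=> [_ [x Ux]] /fintype.subsetP ts t0; split=> //; exists x => i /ts si.
exact: Ux.
Qed.

Definition nerve : scomplex I :=
  SComplex nerve_simplex_neq0 nerve_simplex_sub.

End nerve.

Section kfold.
Variables (R : realType) (d : nat).
Local Notation E := 'rV[R]_d.
Implicit Types (P A Q : {fset E}) (k : nat) (p : seq E) (x : E) (r : R).

(** The norm that the library puts on ['rV[R]_d] is the sup norm (it induces the
    same topology). *)
Definition edist (x y : E) : R := Num.sqrt (\sum_i (x ord0 i - y ord0 i) ^+ 2).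

Definition eball (a : E) r : set E := [set x | edist x a <= r].

Definition ksubsets P k : {fset {fset E}} :=
  [fset A in fpowerset P | #|` A| == k]%fset.

Definition lens r A : set E := \bigcap_(a in [set` A]) eball a r.

Definition kfold_cover P k r : set E :=
  \bigcup_(A in [set` ksubsets P k]) lens r A.

Lemma kfold_cover_mono P k (r s : R) : 0 <= r <= s ->
  kfold_cover P k r `<=` kfold_cover P k s.
Proof.
move=> /andP[_ rs] x [A PA rA]; exists A => // a Aa.
exact: le_trans (rA a Aa) rs.
Qed.

Definition kfold_filtration P k : filtration R :=
  subspace_filtration (@kfold_cover_mono P k).

(** [d^k(x, Q)], meaningful for [1 <= k <= #|Q|]. *)
Definition kdist k x Q : R :=
  nth 0 (sort <=%R [seq edist x q | q <- enum_fset Q]) k.-1.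

Definition prefix_set p (i : nat) : {fset E} := [fset x in take i p]%fset.

(** Sequences are indexed from 0: [nth 0 p i] is the point [p_{i+1}], to be
    compared with the prefix [P_i]. *)
Definition kdistance_permutation P k p : Prop :=
  [/\ uniq p, p =i P &
      forall i : nat, (k <= i < size p)%N ->
      forall q : E, q \in P -> q \notin prefix_set p i ->
        kdist k q (prefix_set p i) <= kdist k (nth 0 p i) (prefix_set p i)].

Definition lambda k p x : \bar R :=
  let i := index x p in
  if (i < k)%N then +oo%E else (kdist k x (prefix_set p i))%:E.

Definition frz (eps' : R) k p x : \bar R :=
  (((1 + eps') / eps')%:E * lambda k p x)%E.

Definition frz_set (eps' : R) k p A : \bar R :=
  \big[Order.min/+oo%E]_(x <- enum_fset A) frz eps' k p x.

(** In the second case [frz_set eps' k p A] is finite. *)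
Definition frozen_lens (eps' : R) k p r A : set E :=
  let F := frz_set eps' k p A in
  if (r%:E < F)%E then lens r A
  else if (r%:E <= (1 + eps')%:E * F)%E then lens (fine F) A
  else set0.

Definition cone (eps' : R) k p r A : set (E * R) :=
  [set y | 0 <= y.2 <= r /\ frozen_lens eps' k p y.2 A y.1].

Definition sparse_cech (eps : R) P k p r : scomplex (ksubsets P k) :=
  nerve (fun A : ksubsets P k => cone (eps / 3) k p r (val A)).

(** [xget] picks the integer [z], which exists and is unique when [0 < eps] and
    [0 < r]. *)
Definition discrete_scale (eps r : R) : R :=
  if 0 < r then
    (1 + eps / 3) ^ (xget (0 : int)
      [set z : int | (1 + eps / 3) ^ z <= r < (1 + eps / 3) ^ (z + 1)])
  else 0.

Definition discrete_sparse_cech (eps : R) P k p r : scomplex (ksubsets P k) :=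
  sparse_cech eps P k p (discrete_scale eps r).

Lemma discrete_scaleP (eps r : R) : 0 < eps -> 0 < r ->
  exists2 z : int, discrete_scale eps r = (1 + eps / 3) ^ z &
    (1 + eps / 3) ^ z <= r < (1 + eps / 3) ^ (z + 1).
Proof.
move=> e0 r0; rewrite /discrete_scale r0; set c := 1 + eps / 3.
have c1 : 1 < c by rewrite ltrDl divr_gt0.
have c0 : 0 < c by exact: lt_trans c1.
have lc : 0 < ln c by rewrite ln_gt0.
have cE (z : int) : c ^ z = expR (z%:~R * ln c).
  by rewrite -powR_intmul ?ltW// /powR gt_eqF.
case: xgetP => [z _ /= zP|/(_ (Num.floor (ln r / ln c)))]; first by exists z.
case=> /=; rewrite !cE -{2 3}[r]lnK ?posrE// ler_expR ltr_expR.
by rewrite -ler_pdivlMr// -ltr_pdivrMr// floor_le_tmp floorD1_gt.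
Qed.

Lemma discrete_scale_mono (eps r s : R) : 0 < eps -> 0 <= r <= s ->
  discrete_scale eps r <= discrete_scale eps s.
Proof.
move=> e0 /andP[r0 rs].
have c1 : 1 < 1 + eps / 3 by rewrite ltrDl divr_gt0.
have [s0|s0] := ltP 0 s; last first.
  by rewrite /discrete_scale !ltNge s0 (le_trans rs s0).
have [t ->] := discrete_scaleP e0 s0.
move: r0; rewrite le_eqVlt => /orP[/eqP <- _|r0].
  by rewrite /discrete_scale ltxx exprz_ge0// ltW// (lt_trans _ c1).
have [z ->] := discrete_scaleP e0 r0.
move=> /andP[zr _] /andP[_ st]; rewrite ler_eXz2l// -ltzD1.
by rewrite -(ltr_eXz2l c1) (le_lt_trans zr)// (le_lt_trans rs).
Qed.

Lemma discrete_sparse_cech_mono (eps : R) P k p (eps0 : 0 < eps) (r s : R) :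
  0 <= r <= s ->
  realization R (discrete_sparse_cech eps P k p r) `<=`
  realization R (discrete_sparse_cech eps P k p s).
Proof.
move=> rs t [t0 t1 [n0 [y Uy]]]; split=> //; split=> //; exists y => A /Uy.
move=> [/andP[y0 yr] ?]; split=> //; rewrite y0 (le_trans yr)//.
exact: discrete_scale_mono.
Qed.

Definition discrete_sparse_cech_filtration (eps : R) (eps0 : 0 < eps) P k p :
    filtration R :=
  subspace_filtration (@discrete_sparse_cech_mono eps P k p eps0).

End kfold.

(* Main.v *)
(** Writing e = eps / 3, let T_r be the union of the frozen lenses at scale r.
    If x lies in a lens of radius r, then each of its centres not inserted
    before the insertion radius drops to e r has k early points within e r;
    hence x lies in a lens of radius (1 + e) r with centres that are not yet
    frozen at (1 + e) r. So T_r is contained in L_r, which is contained in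
    T_((1 + e) r), and a point of the union U_r of the cones can be moved
    vertically up to height r inside U_r; in particular U_r retracts onto its
    top slice T_r. Since (1 + e)^2 <= 1 + eps, the family of the T_r at discrete
    scales is (1 + eps)-interleaved with L by inclusions.

    It remains to find homotopy equivalences |S_r| -> T_r commuting with the
    inclusions. For a set s of lenses let b_s be a lowest common point of their
    cones (at all scales). A point t of |S_r| is sent to the average of the b_s
    with weights that vanish unless every coordinate of t in s is positive and
    exceeds every coordinate outside s, and then to its projection to R^d. This
    does not depend on r, and the average lies in every cone A at which t is
    maximal. The homotopy inverse sends x to a partition of unity at (x, r)
    subordinate to small neighbourhoods of the cones which, by compactness, have
    the same nerve; its maximal coordinates are the cones containing (x, r).
    Thus one composite is joined to the identity by segments inside the convex
    cones. *)

Require Import Defs.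
From mathcomp Require Import all_boot all_order all_algebra finmap.
From mathcomp Require Import all_classical all_reals all_analysis.
From mathcomp Require Import ring lra.
Import Order.TTheory GRing.Theory Num.Theory.
Import numFieldNormedType.Exports.
Local Open Scope classical_set_scope.
Local Open Scope ring_scope.

Set Implicit Arguments.
Unset Strict Implicit.
Unset Printing Implicit Defensive.

(** * Continuity and homotopies *)

Section topology.
Variable R : realType.
Implicit Types X Y Z : topologicalType.

Lemma continuous_set_type X Y (B : set Y) (f : X -> B) :
  continuous (fun x => \val (f x)) -> continuous f.
Proof.
by move=> /continuousP cf; apply/continuousP => _ [V oV <-]; exact: cf.
Qed.

Lemma continuous_set_val X (B : set X) : continuous (fun x : B => \val x).
Proof. exact: initial_continuous. Qed.

Lemma continuous_ptws X (V : Type) Y (f : X -> {ptws V -> Y}) :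
  (forall v, continuous (fun x => f x v)) -> continuous f.
Proof.
move=> cf x; apply/cvg_sup => v.
apply/cvg_image; first by rewrite eqEsubset; split=> y // _; exists (fun=> y).
move=> A nA; exists (fun g : V -> Y => A (g v)); first exact: (cf v x).
rewrite eqEsubset; split => [y [g ? <-]//|y Ay].
by exists (fun=> y).
Qed.

Lemma continuous_eval (V : eqType) Y (v : V) :
  continuous (fun g : {ptws V -> Y} => g v).
Proof. exact: (@proj_continuous V (fun=> Y) v). Qed.

Lemma continuous_sum (M : normedModType R) X (I : Type) (s : seq I)
    (P : pred I) (f : I -> X -> M) :
  (forall i, continuous (f i)) ->
  continuous (fun x => \sum_(i <- s | P i) f i x).
Proof.
move=> cf x; rewrite -[fun=> _]fct_sumE.
elim/big_rec: _ => [|i g _ cg]; first exact: cst_continuous.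
by apply: continuousD => //; exact: cf.
Qed.

Lemma continuous_prod X (I : Type) (s : seq I) (P : pred I) (f : I -> X -> R) :
  (forall i, continuous (f i)) ->
  continuous (fun x => \prod_(i <- s | P i) f i x).
Proof.
move=> cf x; elim: s => [|i s IH].
  by under eq_fun do rewrite big_nil; exact: cst_continuous.
under eq_fun do rewrite big_cons; case: (P i) => //.
by apply: (@continuousM _ _ (f i)) => //; exact: cf.
Qed.

Lemma continuous_pospart X (f : X -> R) :
  continuous f -> continuous (fun x => Num.max 0 (f x)).
Proof.
move=> cf x.
by apply: (@continuous_max _ _ (fun=> 0)); [exact: cst_continuous|exact: cf].
Qed.

Lemma continuous_add (M : normedModType R) X (f g : X -> M) :
  continuous f -> continuous g -> continuous (fun x => f x + g x).
Proof. by move=> cf cg x; apply: continuousD; [exact: cf|exact: cg]. Qed.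

Lemma continuous_sub (M : normedModType R) X (f g : X -> M) :
  continuous f -> continuous g -> continuous (fun x => f x - g x).
Proof. by move=> cf cg x; apply: continuousB; [exact: cf|exact: cg]. Qed.

Lemma continuous_mul X (f g : X -> R) :
  continuous f -> continuous g -> continuous (fun x => f x * g x).
Proof. by move=> cf cg x; apply: continuousM; [exact: cf|exact: cg]. Qed.

Lemma continuous_scale (M : normedModType R) X (f : X -> R) (g : X -> M) :
  continuous f -> continuous g -> continuous (fun x => f x *: g x).
Proof. by move=> cf cg x; apply: continuousZ; [exact: cf|exact: cg]. Qed.

Lemma continuous_pair X Y Z (f : X -> Y) (g : X -> Z) :
  continuous f -> continuous g -> continuous (fun x => (f x, g x)).
Proof. by move=> cf cg x; apply: cvg_pair; [exact: cf|exact: cg]. Qed.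

Lemma continuous_of_comp X Y Z (g : Y -> Z) (f : X -> Y) :
  continuous g -> continuous f -> continuous (fun x => g (f x)).
Proof. by move=> cg cf x; apply: continuous_comp; [exact: cf|exact: cg]. Qed.

Lemma continuous_fst X Y : continuous (@fst X Y).
Proof. by move=> x; exact: cvg_fst. Qed.

Lemma continuous_snd X Y : continuous (@snd X Y).
Proof. by move=> x; exact: cvg_snd. Qed.

Lemma continuous_cst X Y (y : Y) : continuous (fun _ : X => y).
Proof. exact: cst_continuous. Qed.

(** Composing the time with [clamp] extends a homotopy formula valid on [0, 1] to all times, keeping
    it continuous and inside the target subspace. *)
Definition clamp (s : R) : R := Num.max 0 (Num.min s 1).

Lemma clamp_itv s : 0 <= clamp s <= 1.
Proof. by rewrite /clamp le_max lexx /= ge_max ler01 ge_min lexx orbT. Qed.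

Lemma clamp_id s : 0 <= s <= 1 -> clamp s = s.
Proof. by case/andP=> s0 s1; rewrite /clamp (min_idPl s1) (max_idPr s0). Qed.

Lemma continuous_clamp : continuous clamp.
Proof.
apply: continuous_pospart => s.
by apply: (@continuous_min _ _ idfun); [exact: cvg_id|exact: cst_continuous].
Qed.

Lemma homotopic_set_type X Y (B : set Y) (f g : X -> B) (h : X -> R -> Y) :
  continuous (fun z : X * R => h z.1 (clamp z.2)) ->
  (forall x s, 0 <= s <= 1 -> B (h x s)) ->
  (forall x, h x 0 = \val (f x)) -> (forall x, h x 1 = \val (g x)) ->
  homotopic R f g.
Proof.
move=> ch hB h0 h1.
exists (fun z => exist _ (h z.1 (clamp z.2))
  (mem_set (hB z.1 _ (clamp_itv z.2))) : B); split.
- by apply: continuous_subspaceT; apply: continuous_set_type.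
- by move=> x; apply: val_inj; rewrite /= clamp_id ?h0// lexx ler01.
- by move=> x; apply: val_inj; rewrite /= clamp_id ?h1// lexx ler01.
Qed.

Lemma homotopic_refl X Y (f : X -> Y) : continuous f -> homotopic R f f.
Proof.
move=> cf; exists (fun z => f z.1); split=> //; apply: continuous_subspaceT.
exact: (continuous_of_comp cf (@continuous_fst _ _)).
Qed.

End topology.

(** * Weighted averages in convex sets *)

Section convex.
Variables (R : realType) (M : lmodType R).

Definition segment_closed (K : set M) : Prop := forall (s : R) (x y : M),
  0 <= s <= 1 -> K x -> K y -> K (s *: x + (1 - s) *: y).

Lemma convex_wavg (I : Type) (l : seq I) (P : pred I) (K : set M) (w : I -> R)
    (c : I -> M) :
  segment_closed K -> K !=set0 -> (forall i, P i -> 0 <= w i) ->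
  (forall i, P i -> w i != 0 -> K (c i)) -> 0 < \sum_(i <- l | P i) w i ->
  K ((\sum_(i <- l | P i) w i)^-1 *: \sum_(i <- l | P i) w i *: c i).
Proof.
move=> Kc [x0 Kx0] w0 Kw W0.
(* Factoring out [q] without dividing lets the induction pass through partial sums of weight 0,
   where [q] may be any point of [K]. *)
suff [q [Kq -> _]] : exists q, [/\ K q,
    \sum_(i <- l | P i) w i *: c i = (\sum_(i <- l | P i) w i) *: q &
    0 <= \sum_(i <- l | P i) w i].
  by rewrite scalerA mulVf ?scale1r// gt_eqF.
elim: l {W0} => [|i l [q [Kq Eq S0]]]; first by
  exists x0; rewrite !big_nil scale0r.
rewrite !big_cons; case: ifPn => Pi; last by exists q.
have [wi0|wi0] := eqVneq (w i) 0.
  by exists q; rewrite wi0 scale0r !add0r.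
have wip : 0 < w i by rewrite lt_def wi0 w0.
set S := \sum_(j <- l | P j) w j in S0 Eq *.
have WS : 0 < w i + S by apply: ltr_pwDl.
exists ((w i / (w i + S)) *: c i + (1 - w i / (w i + S)) *: q); split.
- apply: Kc => //; last exact: Kw.
  by rewrite divr_ge0 ?(ltW wip) ?(ltW WS)//= ler_pdivrMr// mul1r lerDl.
- rewrite Eq scalerDr !scalerA mulrBr mulr1 mulrCA divff ?gt_eqF// mulr1.
  by rewrite (addrC (w i)) addrK.
- exact: ltW.
Qed.

End convex.

(** * Averaging over flags of a simplex *)

Section flag_average.
Variables (R : realType) (V : finType).
Implicit Types (s : {set V}) (t : V -> R).

(** For [t >= 0] and nonempty [s], this is nonzero exactly when [s] is a superlevel set of [t]
    within its support. Such sets form a chain, as in the barycentric subdivision. *)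
Definition flag_weight s t : R :=
  \prod_(v in s) (t v * \prod_(u | u \notin s) Num.max 0 (t v - t u)).

(** The empty set is left out because its weight is an empty product, namely 1. *)
Definition flag_mass t : R :=
  \sum_(s : {set V} | s != finset.set0) flag_weight s t.

Definition flag_average (M : lmodType R) (b : {set V} -> M) t : M :=
  (flag_mass t)^-1 *:
  \sum_(s : {set V} | s != finset.set0) flag_weight s t *: b s.

Definition is_argmax t (a : V) := forall v, t v <= t a.

Lemma ex_argmax t : (exists v, t v != 0) -> exists a, is_argmax t a.
Proof.
move=> [v0 _]; case: (@arg_maxP _ _ _ v0 xpredT t) => // a _ aP.
by exists a => v; exact: aP.
Qed.

Lemma flag_weight_ge0 s t : (forall v, 0 <= t v) -> 0 <= flag_weight s t.
Proof.
move=> t0; apply: prodr_ge0 => v _; apply: mulr_ge0 => //.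
by apply: prodr_ge0 => u _; rewrite le_max lexx.
Qed.

Lemma flag_weight_support s t v : flag_weight s t != 0 -> v \in s -> t v != 0.
Proof.
by move=> /prodf_neq0 + vs => /(_ v vs); rewrite mulf_eq0 negb_or => /andP[].
Qed.

(** If [a] were outside [s], the factor [Num.max 0 (t v - t a)] would vanish for [v] in [s]. *)
Lemma argmax_flag s t a : flag_weight s t != 0 -> s != finset.set0 ->
  is_argmax t a -> a \in s.
Proof.
move=> /prodf_neq0 ws /finset.set0Pn[v vs] ta; apply: contraT => as_.
have := ws v vs; rewrite mulf_eq0 negb_or => /andP[_ /prodf_neq0 /(_ a as_)].
by rewrite (max_idPl _) ?eqxx// subr_le0.
Qed.

Lemma flag_mass_gt0 t : (forall v, 0 <= t v) -> (exists v, t v != 0) ->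
  0 < flag_mass t.
Proof.
move=> t0 tn0; have [a ta] := ex_argmax tn0.
have ta0 : 0 < t a.
  by have [v tv] := tn0; apply: lt_le_trans (ta v); rewrite lt_def tv t0.
(* The set of all maximal coordinates has positive weight. *)
pose s := [set v | t v == t a]%SET.
have as_ : a \in s by rewrite inE.
have s0 : s != finset.set0 by apply/finset.set0Pn; exists a.
rewrite /flag_mass (bigD1 s)//=; apply: ltr_pwDl; last first.
  by apply: sumr_ge0 => i _; exact: flag_weight_ge0.
apply: prodr_gt0 => v; rewrite inE => /eqP ->; apply: mulr_gt0 => //.
apply: prodr_gt0 => u; rewrite inE => una.
by rewrite lt_max ltxx subr_gt0 lt_neqAle una ta.
Qed.

(** Every [b s] of nonzero weight lies in [K], because [s] contains the maximal vertex [a] and lies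
    in the support of [t]. *)
Lemma flag_average_in (M : lmodType R) (b : {set V} -> M) (K : set M) t a :
  segment_closed K -> (forall v, 0 <= t v) -> (exists v, t v != 0) ->
  is_argmax t a ->
  (forall s, a \in s -> (forall v, v \in s -> t v != 0) -> K (b s)) ->
  K (flag_average b t).
Proof.
move=> Kc t0 tn0 ta Kb; apply: convex_wavg => //.
- exists (b [set a]%SET); apply: Kb => [|v]; rewrite inE// => /eqP ->.
  have [v' tv] := tn0; apply: contra tv => /eqP ta0.
  by rewrite eq_le t0 -ta0 ta.
- by move=> s _; exact: flag_weight_ge0.
- move=> s s0 ws; apply: Kb => [|v]; first exact: (argmax_flag ws).
  exact: flag_weight_support.
- exact: flag_mass_gt0.
Qed.

Lemma continuous_flag_weight s :
  continuous (flag_weight s : {ptws V -> R} -> R).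
Proof.
apply: continuous_prod => v t; apply: continuousM; first exact: continuous_eval.
apply: continuous_prod => u; apply: continuous_pospart => t'.
by apply: continuousB; exact: continuous_eval.
Qed.

Lemma continuous_flag_average (M : normedModType R) (b : {set V} -> M)
    (X : topologicalType) (t : X -> {ptws V -> R}) : continuous t ->
  (forall x v, 0 <= t x v) -> (forall x, exists v, t x v != 0) ->
  continuous (fun x => flag_average b (t x)).
Proof.
move=> ct t0 tn0 x.
have cw s : continuous (fun x => flag_weight s (t x)).
  exact: (continuous_of_comp (@continuous_flag_weight s) ct).
apply: (@continuousZ _ _ _ (fun x => (flag_mass (t x))^-1)).
  apply: continuousV; first by rewrite gt_eqF// flag_mass_gt0.
  by apply: continuous_sum.
apply: continuous_sum => s y.
exact: (@continuousZr_tmp _ _ _ _ (b s) _ (cw s y)).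
Qed.

End flag_average.

(** * Barycentric coordinates from nonnegative weights *)

Section normalization.
Variables (R : realType) (V : finType).

Definition normalize (u : V -> R) : {ptws V -> R} := fun v => u v / \sum_w u w.

Lemma normalize_realization (K : scomplex V) (u : V -> R) :
  (forall v, 0 <= u v) -> (exists v, u v != 0) ->
  simplex K [set v | u v != 0]%SET -> realization R K (normalize u).
Proof.
move=> u0 [v uv] Ku; have U0 : 0 < \sum_w u w.
  rewrite (bigD1 v)//=; apply: ltr_pwDl; first by rewrite lt_def uv u0.
  exact: sumr_ge0.
split; first by move=> w; rewrite divr_ge0// ltW.
  by rewrite -mulr_suml divff// gt_eqF.
rewrite (_ : [set v | _]%SET = [set v | u v != 0]%SET)//.
by apply/setP => w; rewrite !inE mulf_eq0 invr_eq0 (gt_eqF U0) orbF.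
Qed.

Lemma normalize_id (u : V -> R) : \sum_v u v = 1 -> normalize u = u.
Proof. by move=> u1; apply/funext => v; rewrite /normalize u1 divr1. Qed.

Lemma continuous_normalize (X : topologicalType) (u : X -> V -> R) :
  (forall v, continuous (fun x => u x v)) -> (forall x v, 0 <= u x v) ->
  (forall x, exists v, u x v != 0) -> continuous (fun x => normalize (u x)).
Proof.
move=> cu u0 un0; apply: continuous_ptws => v x.
apply: (@continuousM _ _ (fun x => u x v)); first exact: cu.
apply: continuousV; last exact: continuous_sum.
have [w uw] := un0 x; rewrite gt_eqF// (bigD1 w)//=.
by apply: ltr_pwDl; [rewrite lt_def uw u0|exact: sumr_ge0].
Qed.

Lemma realization_ex (K : scomplex V) (t : realization R K) :
  exists v, \val t v != 0.
Proof.
have [_ _ /simplex_neq0/finset.set0Pn[v]] := set_mem (valP t).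
by rewrite inE; exists v.
Qed.

Lemma realization_ge0 (K : scomplex V) (t : realization R K) v :
  0 <= \val t v.
Proof. by have [] := set_mem (valP t). Qed.

End normalization.

(** * The nerve theorem for closed convex covers *)

Section nerve_projection.
Variables (R : realType) (E : normedModType R) (V : finType).
Variables (C : V -> set (E * R^o)) (r delta : R) (G : V -> E * R^o -> R).
Variables (b : {set V} -> E * R^o) (T : set E).
Implicit Types (A : V) (s : {set V}) (y : E * R^o).

Let U : set (E * R^o) := \bigcup_A C A.
Let lift y (w : R) : E * R^o := (y.1, (1 - w) * y.2 + w * r).

Hypothesis C_convex : forall A, segment_closed (C A).
Hypothesis U_up : forall y w, 0 <= w <= 1 -> U y -> U (lift y w).
Hypothesis T_top : forall x, T x <-> U (x, r).
Hypothesis G_continuous : forall A, continuous (G A).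
Hypothesis G_ge0 : forall A y, 0 <= G A y.
Hypothesis G_eq0 : forall A y, U y -> G A y = 0 <-> C A y.
Hypothesis delta_gt0 : 0 < delta.
(** The neighbourhoods [G A < delta] of the sets [C A] in [U] have the same nerve as the sets
    themselves. *)
Hypothesis G_nerve : forall s y, U y -> s != finset.set0 ->
  (forall A, A \in s -> G A y < delta) -> simplex (nerve C) s.
Hypothesis b_in : forall s A, simplex (nerve C) s -> A \in s -> C A (b s).

(** An unnormalized partition of unity on [U]. The largest value [delta] is attained exactly on
    [C A], so maximal coordinates detect membership. *)
Let phi y A : R := Num.max 0 (delta - G A y).

Let phi_ge0 y A : 0 <= phi y A. Proof. by rewrite le_max lexx. Qed.

Let phi_neq0 y A : (phi y A != 0) = (G A y < delta).
Proof.
rewrite /phi; case: (leP (delta - G A y) 0) => h.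
  by rewrite eqxx; apply/esym/negbTE; rewrite -leNgt -subr_le0.
by rewrite gt_eqF// -subr_gt0 h.
Qed.

Let phi_in y A : C A y -> phi y A = delta.
Proof.
move=> CAy; have Uy : U y by exists A.
by rewrite /phi (G_eq0 A Uy).2// subr0 (max_idPr _)// ltW.
Qed.

Let continuous_phi A : continuous (phi^~ A).
Proof.
apply: continuous_pospart => y.
by apply: continuousB; [exact: cst_continuous|exact: G_continuous].
Qed.

Let phi_simplex y s : U y -> (exists A, A \in s) ->
  (forall A, A \in s -> phi y A != 0) -> simplex (nerve C) s.
Proof.
move=> Uy s0 sy; apply: (G_nerve Uy); first exact/finset.set0Pn.
by move=> A /sy; rewrite phi_neq0.
Qed.

Let inv (x : E) : {ptws V -> R} := normalize (phi (x, r)).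

Let phi_ex y : U y -> exists A, phi y A != 0.
Proof. by move=> [A _ CA]; exists A; rewrite phi_in// gt_eqF. Qed.

Let inv_in x : T x -> realization R (nerve C) (inv x).
Proof.
move=> /T_top Ux; have [A pA] := phi_ex Ux.
apply: normalize_realization => //; first by exists A.
by apply: (phi_simplex Ux) => [|B]; [exists A; rewrite inE|rewrite inE].
Qed.

Let avg (t : V -> R) := flag_average b t.

(** The sets of nonzero weight are faces of the support of [t], hence simplices of the nerve, and
    they contain [A]; so [b_in] applies to them. *)
Let avg_in (t : V -> R) A : realization R (nerve C) t -> is_argmax t A ->
  C A (avg t).
Proof.
move=> [t0 _ st] tA.
have [v tv] : exists v, t v != 0.
  by have /finset.set0Pn[v] := simplex_neq0 st; rewrite inE; exists v.
rewrite /avg; apply: (flag_average_in (@C_convex A) t0 _ tA); first by exists v.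
move=> s As sv; apply: b_in => //.
apply: (simplex_sub st); last by apply/finset.set0Pn; exists A.
by apply/fintype.subsetP => u /sv; rewrite inE.
Qed.

Let avg_U (t : V -> R) : realization R (nerve C) t -> U (avg t).
Proof.
move=> Kt; have [_ _ st] := Kt.
have [v] : exists v, v \in [set v | t v != 0]%SET.
  by apply/finset.set0Pn; exact: simplex_neq0 st.
rewrite inE => tv; have [A tA] : exists A, is_argmax t A.
  by apply: ex_argmax; exists v.
by exists A => //; exact: avg_in.
Qed.

Let lift0 y : lift y 0 = y.
Proof. by case: y => x a; rewrite /lift subr0 mul1r mul0r addr0. Qed.

Let lift1 y : lift y 1 = (y.1, r).
Proof. by rewrite /lift subrr mul0r mul1r add0r. Qed.

Lemma nerve_projection_maps (t : realization R (nerve C)) :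
  T (flag_average b (\val t)).1.
Proof.
apply/T_top; have := U_up _ (avg_U (set_mem (valP t))).
by move=> /(_ 1); rewrite lift1; apply; rewrite ler01 lexx.
Qed.

(* Normalized, [path t s] is the inverse image of the projection of [avg t] at
   [s = 0] and [t] at [s = 1]. For [s <= 1/2] the weights are supported where
   [phi] is nonzero at the point [lift (avg t) (up s)], for [s >= 1/2] in the
   support of [t]; at [s = 1/2], [t * phi (avg t)] satisfies both. *)
Let up (s : R) : R := Num.max 0 (1 - 2 * s).
Let down (s : R) : R := Num.max 0 (2 * s - 1).
Let path (t : V -> R) (s : R) (A : V) : R :=
  down s * t A + (1 - down s) *
    (((1 - up s) * t A + up s) * phi (lift (avg t) (up s)) A).

Let up_down (s : R) : 0 <= s <= 1 ->
  [/\ 0 <= up s <= 1, 0 <= down s <= 1 & up s = 0 /\ 0 < down s \/ down s = 0].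
Proof.
move=> s01; rewrite /up /down.
case: (leP (2 * s - 1) 0) => h1; case: (leP (1 - 2 * s) 0) => h2;
  split; try lra.
Qed.

Let path_ge0 t (s : R) A : realization R (nerve C) t -> 0 <= s <= 1 ->
  0 <= path t s A.
Proof.
move=> [t0 _ _] /up_down[/andP[u0 u1] /andP[d0 d1] _].
apply: addr_ge0; first exact: mulr_ge0.
apply: mulr_ge0; first by rewrite subr_ge0.
apply: mulr_ge0 => //; apply: addr_ge0 => //.
by apply: mulr_ge0 => //; rewrite subr_ge0.
Qed.

Let path_ex t (s : R) : realization R (nerve C) t -> 0 <= s <= 1 ->
  exists A, path t s A != 0.
Proof.
move=> Kt s01; have [/andP[u0 u1] /andP[d0 d1] ud] := up_down s01.
have [t0 _ /simplex_neq0/finset.set0Pn[v]] := Kt; rewrite inE => tv.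
have [A tA] : exists A, is_argmax t A by apply: ex_argmax; exists v.
have tA0 : 0 < t A by apply: lt_le_trans (tA v); rewrite lt_def tv t0.
have CA := avg_in Kt tA.
case: ud => [[u00 d00]|d00].
  exists A; rewrite gt_eqF// /path u00 lift0 phi_in// subr0 mul1r addr0.
  apply: ltr_pwDl; first exact: mulr_gt0.
  by rewrite mulr_ge0 ?subr_ge0// mulr_ge0// ltW.
have [u00|un0] := eqVneq (up s) 0.
  (* Here [s = 1/2]: a maximal coordinate of [t] survives in the product, since [avg t] lies in its
     set. *)
  exists A; rewrite gt_eqF// /path d00 u00 lift0 phi_in//.
  by rewrite mul0r add0r !subr0 !mul1r addr0 mulr_gt0.
(* For [up s > 0] the factor before [phi] is positive at every vertex, so any set containing the
   lifted point yields a positive coordinate. *)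
have [B _ CB] : U (lift (avg t) (up s)).
  by apply: U_up; [exact/andP|exact: avg_U].
exists B; rewrite gt_eqF// /path d00 phi_in// mul0r add0r subr0 mul1r.
rewrite mulr_gt0// ltr_wpDl//; last by rewrite lt_def un0 u0.
by rewrite mulr_ge0// subr_ge0.
Qed.

Let path_in t (s : R) : realization R (nerve C) t -> 0 <= s <= 1 ->
  realization R (nerve C) (normalize (path t s)).
Proof.
move=> Kt s01; have [u01 _ ud] := up_down s01.
have [A pA] := path_ex Kt s01.
apply: normalize_realization; [by move=> ?; exact: path_ge0|by exists A|].
have [_ _ st] := Kt.
have pn0 : exists A, A \in [set A | path t s A != 0]%SET.
  by exists A; rewrite inE.
case: ud => [[u00 _]|d00].
  apply: (simplex_sub st); last exact/finset.set0Pn.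
  apply/fintype.subsetP => B; rewrite !inE; apply: contra => /eqP tB.
  by rewrite /path u00 tB !mulr0 addr0 mul0r mulr0 addr0.
apply: (phi_simplex (y := lift (avg t) (up s))) => //.
  by apply: U_up => //; exact: avg_U.
move=> B; rewrite inE; apply: contra => /eqP pB.
by rewrite /path d00 pB !mulr0 mul0r addr0.
Qed.

Let continuous_avg :
  continuous (fun t : realization R (nerve C) => avg (\val t)).
Proof.
apply: continuous_flag_average.
- exact: continuous_set_val.
- exact: realization_ge0.
- exact: realization_ex.
Qed.

Let continuous_path A : continuous
  (fun z : realization R (nerve C) * R => path (\val z.1) (clamp z.2) A).
Proof.
have ct : continuous (fun z : realization R (nerve C) * R => \val z.1 A).
  have cv := continuous_of_comp
    (@continuous_set_val _ (realization R (nerve C))) (@continuous_fst _ R).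
  exact: (continuous_of_comp (@continuous_eval V R A) cv).
have cs : continuous (fun z : realization R (nerve C) * R => clamp z.2).
  exact: (continuous_of_comp (@continuous_clamp _) (@continuous_snd _ _)).
have c2s : continuous (fun z : realization R (nerve C) * R => 2 * clamp z.2).
  by apply: continuous_mul => //; exact: continuous_cst.
have cu : continuous (fun z : realization R (nerve C) * R => up (clamp z.2)).
  apply: continuous_pospart; apply: continuous_sub => //.
  exact: continuous_cst.
have cd : continuous (fun z : realization R (nerve C) * R => down (clamp z.2)).
  apply: continuous_pospart; apply: continuous_sub => //.
  exact: continuous_cst.
have ca : continuous (fun z : realization R (nerve C) * R => avg (\val z.1)).
  exact: (continuous_of_comp continuous_avg (@continuous_fst _ _)).
have cl : continuous (fun z : realization R (nerve C) * R =>
    lift (avg (\val z.1)) (up (clamp z.2))).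
  apply: continuous_pair.
    exact: (continuous_of_comp (@continuous_fst _ _) ca).
  apply: continuous_add; apply: continuous_mul => //.
  - by apply: continuous_sub => //; exact: continuous_cst.
  - exact: (continuous_of_comp (@continuous_snd _ _) ca).
  - exact: continuous_cst.
apply: continuous_add; apply: continuous_mul => //.
  by apply: continuous_sub => //; exact: continuous_cst.
have cp := continuous_of_comp (@continuous_phi A) cl.
apply: continuous_mul; last exact: cp.
apply: continuous_add => //; apply: continuous_mul => //.
by apply: continuous_sub => //; exact: continuous_cst.
Qed.

Let continuous_inv : continuous (fun x : T => inv (\val x)).
Proof.
apply: continuous_normalize => [A|x A|x].
- apply: (@continuous_of_comp _ _ _ (phi^~ A)); first exact: continuous_phi.
  apply: continuous_pair; first exact: continuous_set_val.
  exact: continuous_cst.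
- exact: phi_ge0.
- by apply: phi_ex; apply/T_top; exact: set_mem (valP x).
Qed.

Lemma nerve_projection_equivalence (f : realization R (nerve C) -> T) :
  (forall t, \val (f t) = (flag_average b (\val t)).1) ->
  homotopy_equivalence R f.
Proof.
move=> fE; split.
  apply: continuous_set_type.
  have -> : (fun t => \val (f t)) = (fun t => (avg (\val t)).1) by exact/funext.
  exact: (continuous_of_comp (@continuous_fst _ _) continuous_avg).
pose g (x : T) : realization R (nerve C) :=
  exist _ (inv (\val x)) (mem_set (inv_in (set_mem (valP x)))).
exists g; split.
- by apply: continuous_set_type; exact: continuous_inv.
- have down1 : down 1 = 1 by rewrite /down mulr1 (max_idPr _); lra.
  have up1 : up 1 = 0 by rewrite /up mulr1 (max_idPl _)//; lra.
  have down0 : down 0 = 0 by rewrite /down mulr0 (max_idPl _)//; lra.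
  have up0 : up 0 = 1 by rewrite /up mulr0 (max_idPr _); lra.
  refine (@homotopic_set_type _ _ {ptws V -> R} (realization R (nerve C))
    (g \o f) idfun (fun t (s : R) => normalize (path (\val t) s)) _ _ _ _) =>
    [|t s s01|t|t].
  + apply: continuous_normalize => [A|z A|z]; first exact: continuous_path.
      by apply: path_ge0; [exact: set_mem (valP z.1)|exact: clamp_itv].
    by apply: path_ex; [exact: set_mem (valP z.1)|exact: clamp_itv].
  + by apply: path_in => //; exact: set_mem (valP t).
  + rewrite /= /inv fE; congr normalize; apply/funext => A.
    by rewrite /path down0 up0 mul0r subrr mul0r subr0 !add0r !mul1r lift1.
  + have [_ t1 _] := set_mem (valP t).
    rewrite -[RHS](normalize_id t1); congr normalize; apply/funext => A.
    by rewrite /path down1 subrr mul0r addr0 mul1r.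
(* A maximal coordinate of [inv x] names a convex set containing both ends of the segment from
   [(x, r)] to its average. *)
- have line x : T x -> exists A, C A (x, r) /\ C A (avg (inv x)).
    move=> Tx; have /T_top Ux := Tx.
    have [A iA] : exists A, is_argmax (inv x) A.
      apply: ex_argmax; have [_ _ /simplex_neq0/finset.set0Pn[v]] := inv_in Tx.
      by rewrite inE; exists v.
    exists A; split; last by apply: avg_in => //; exact: inv_in.
    (* Comparison with a set [B] containing [(x, r)] forces [phi (x, r) A >= delta > 0], hence
       [G A (x, r) = 0]. *)
    have [B _ CB] := Ux.
    apply/(G_eq0 _ Ux)/eqP; rewrite eq_le G_ge0 andbT.
    have := iA B; rewrite /inv /normalize ler_pM2r; last first.
      rewrite invr_gt0 (bigD1 B)//= phi_in//.
      by apply: ltr_pwDl => //; exact: sumr_ge0.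
    rewrite (phi_in CB) /phi le_max; case/orP; first by rewrite leNgt delta_gt0.
    by rewrite lerDl oppr_ge0.
  refine (@homotopic_set_type _ _ _ T (f \o g) idfun (fun x (s : R) =>
    s *: \val x + (1 - s) *: (avg (inv (\val x))).1) _ _ _ _) => [|x s s01|x|x].
  + have ci : continuous (fun x : T => (avg (inv (\val x))).1).
      apply: (continuous_of_comp (@continuous_fst _ _)).
      apply: continuous_flag_average.
      * exact: continuous_inv.
      * by move=> y v; have [] := inv_in (set_mem (valP y)).
      * move=> y; have [_ _] := inv_in (set_mem (valP y)).
        by move=> /simplex_neq0/finset.set0Pn[v]; rewrite inE; exists v.
    have cs : continuous (fun z : T * R => clamp z.2).
      exact: (continuous_of_comp (@continuous_clamp _) (@continuous_snd _ _)).
    apply: continuous_add; apply: continuous_scale => //.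
    * exact: (continuous_of_comp (@continuous_set_val _ _)
        (@continuous_fst _ _)).
    * by apply: continuous_sub => //; exact: continuous_cst.
    * exact: (continuous_of_comp ci (@continuous_fst _ _)).
  + have [A [Ax Ai]] := line _ (set_mem (valP x)).
    have := C_convex s01 Ax Ai.
    (* The segment may leave height [r]; lifting it back inside [U] leaves its projection
       unchanged. *)
    move=> CA; have := @U_up _ 1 _ (ex_intro2 _ _ A I CA).
    by rewrite lift1 => UA; apply/T_top/UA; rewrite ler01 lexx.
  + by rewrite /= scale0r add0r subr0 scale1r fE.
  + by rewrite /= scale1r subrr scale0r addr0.
Qed.

End nerve_projection.

(** * Euclidean geometry *)

Section euclidean.
Variables (R : realType) (d : nat).
Implicit Types (u v x y a : 'rV[R]_d).
Local Notation edist := (@Defs.edist R d).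

Definition enorm u : R := Num.sqrt (\sum_i u ord0 i ^+ 2).

Lemma edistE x y : edist x y = enorm (x - y).
Proof.
by rewrite /Defs.edist /enorm; under [in RHS]eq_bigr do rewrite !mxE.
Qed.

Lemma sum_sqr_ge0 u : 0 <= \sum_i u ord0 i ^+ 2.
Proof. by apply: sumr_ge0 => i _; exact: sqr_ge0. Qed.

Lemma enorm_ge0 u : 0 <= enorm u. Proof. exact: sqrtr_ge0. Qed.

Lemma enormZ s u : 0 <= s -> enorm (s *: u) = s * enorm u.
Proof.
move=> s0; rewrite /enorm; under eq_bigr do rewrite mxE exprMn.
by rewrite -mulr_sumr sqrtrM ?sqr_ge0// sqrtr_sqr ger0_norm.
Qed.

Lemma cauchy_schwarz u v : \sum_i u ord0 i * v ord0 i <= enorm u * enorm v.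
Proof.
set A := \sum_i u ord0 i ^+ 2; set B := \sum_i v ord0 i ^+ 2.
set C := \sum_i _.
rewrite /enorm -sqrtrM ?sum_sqr_ge0//; apply: le_trans (ler_norm _) _.
rewrite -sqrtr_sqr ler_sqrt ?mulr_ge0 ?sum_sqr_ge0//.
have [B0|Bn0] := eqVneq B 0.
  rewrite -/B B0 mulr0 (_ : C = 0) ?expr0n//.
  apply: big1 => i _; suff -> : v ord0 i = 0 by rewrite mulr0.
  apply/eqP; rewrite -sqrf_eq0; apply/eqP.
  by apply: (psumr_eq0P _ B0) => // j _; exact: sqr_ge0.
have Bp : 0 < B by rewrite lt_def Bn0 sum_sqr_ge0.
(* After multiplication by [B], the difference is the squared norm of [B *: u - C *: v]. *)
rewrite -subr_ge0 -(pmulr_rge0 _ Bp).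
have -> : B * (A * B - C ^+ 2) = \sum_i (B * u ord0 i - C * v ord0 i) ^+ 2.
  transitivity (\sum_i (B ^+ 2 * u ord0 i ^+ 2 +
      ((- 2 * B * C) * (u ord0 i * v ord0 i) + C ^+ 2 * v ord0 i ^+ 2))).
    by rewrite !big_split/= -!mulr_sumr -/A -/B -/C; ring.
  by apply: eq_bigr => i _; ring.
by apply: sumr_ge0 => i _; exact: sqr_ge0.
Qed.

Lemma enormD u v : enorm (u + v) <= enorm u + enorm v.
Proof.
rewrite -(ler_pXn2r (n := 2)) ?nnegrE ?addr_ge0 ?enorm_ge0//.
rewrite sqrrD !sqr_sqrtr ?sum_sqr_ge0//.
under eq_bigr do rewrite mxE sqrrD.
rewrite 2!big_split lerD2r lerD2l sumrMnl lerMn2r.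
exact: cauchy_schwarz.
Qed.

Lemma edist_ge0 x y : 0 <= edist x y. Proof. exact: sqrtr_ge0. Qed.

Lemma edist_triangle y x z : edist x z <= edist x y + edist y z.
Proof. by rewrite !edistE -(subrKA y) enormD. Qed.

Lemma edist_xx x : edist x x = 0.
Proof.
rewrite /Defs.edist big1 ?sqrtr0// => i _.
by rewrite subrr expr0n.
Qed.

Lemma edist_convex s x y a : 0 <= s <= 1 ->
  edist (s *: x + (1 - s) *: y) a <= s * edist x a + (1 - s) * edist y a.
Proof.
case/andP=> s0 s1; rewrite !edistE.
rewrite (_ : _ - a = s *: (x - a) + (1 - s) *: (y - a)); last first.
  by apply/rowP => i; rewrite !mxE; ring.
by apply: le_trans (enormD _ _) _; rewrite !enormZ// subr_ge0.
Qed.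

Lemma continuous_edist a : continuous (fun x => edist x a).
Proof.
apply: (continuous_of_comp (@sqrt_continuous R)).
apply: continuous_sum => i.
have -> : (fun x : 'rV[R]_d => (x ord0 i - a ord0 i) ^+ 2) =
          (fun x : 'rV[R]_d => (x ord0 i - a ord0 i) * (x ord0 i - a ord0 i)).
  by apply/funext => x; rewrite expr2.
by apply: continuous_mul; apply: continuous_sub;
  do ?[exact: coord_continuous|exact: continuous_cst].
Qed.

(** Coordinates differ by at most the Euclidean distance, so the ball is a closed subset of a
    compact box. *)
Lemma compact_eball a (r : R) : compact (eball a r).
Proof.
have cl : closed (eball a r).
  have -> : eball a r = (fun x => edist x a) @^-1` [set t | t <= r] by [].
  by apply: closed_comp => [x _|]; [exact: continuous_edist|exact: closed_le].
have cK := @rV_compact R d (fun i => `[a ord0 i - r, a ord0 i + r]%classic)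
  (fun i => @segment_compact _ _ _).
apply: (subclosed_compact cl cK) => x xr i /=.
rewrite in_itv/= -ler_distlC distrC.
apply: le_trans xr; rewrite -sqrtr_sqr ler_sqrt ?sumr_ge0//; last first.
  by move=> j _; exact: sqr_ge0.
by rewrite (bigD1 i)//= lerDl sumr_ge0// => j _; exact: sqr_ge0.
Qed.

Lemma kdist_subset k x (Q : {fset 'rV[R]_d}) (m : R) : (0 < k <= #|` Q|)%N ->
  kdist k x Q <= m ->
  exists B : {fset 'rV[R]_d}, [/\ (B `<=` Q)%fset, #|` B| = k &
    forall b, b \in B -> edist x b <= m].
Proof.
(* Sorting the points by distance, rather than the distances, makes the first [k] points the
   required [B]; the entry at [k.-1] bounds their distances. *)
case/andP=> k0 kQ; rewrite /kdist sort_map; set q := sort _ _.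
have sq : size q = #|` Q| by rewrite size_sort.
have q_uniq : uniq q by rewrite sort_uniq fset_uniq.
have qs : sorted <=%R (map (edist x) q).
  by rewrite /q -sort_map; apply: sort_sorted; exact: le_total.
move=> km; exists [fset y in take k q]%fset; split.
- apply/fsubsetP => y; rewrite in_fset /= => /mem_take.
  by rewrite mem_sort.
- by rewrite card_fseq undup_id ?take_uniq// size_takel// sq.
- move=> y; rewrite in_fset /= => yk; apply: le_trans km.
  have kq : (k <= size q)%N by rewrite sq.
  have iy : (index y (take k q) < k)%N.
    by rewrite -[ltnRHS](size_takel kq) index_mem.
  have -> : edist x y = [seq edist x z | z <- q]`_(index y (take k q)).
    rewrite (nth_map 0); last exact: leq_trans iy kq.
    have <- := nth_take 0 iy q.
    by rewrite nth_index.
  apply: (sorted_leq_nth le_trans le_refl _ qs); rewrite ?inE ?size_map.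
  + exact: leq_trans iy kq.
  + by rewrite prednK.
  + by rewrite -ltnS prednK.
Qed.

End euclidean.

(** * Sparse lenses and cones *)

Section sparse_lenses.
Variables (R : realType) (d : nat).
Local Notation E := 'rV[R]_d.
Local Notation edist := (@Defs.edist R d).
Variables (e : R) (k : nat) (P : {fset E}) (p : seq E).
Hypothesis e0 : 0 < e.
Hypothesis kP : (0 < k <= #|` P|)%N.
Hypothesis hp : kdistance_permutation P k p.
Implicit Types (A B : {fset E}) (x a : E) (r alpha : R) (y : E * R^o).

(** * Freezing times and replacement of frozen lenses *)

Lemma kdist_ge0 x A : 0 <= kdist k x A.
Proof.
rewrite /kdist; set s := sort _ _.
have [ks|ks] := ltnP k.-1 (size s); last by rewrite nth_default.
have : s`_k.-1 \in s by exact: mem_nth.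
by rewrite mem_sort => /mapP[z _ ->]; exact: edist_ge0.
Qed.

Lemma frz_ge0 x : (0 <= frz e k p x)%E.
Proof.
apply: mule_ge0; first by rewrite lee_fin divr_ge0// ltW// addr_gt0.
by rewrite /lambda; case: ifP => _; rewrite ?leey// lee_fin kdist_ge0.
Qed.

Lemma frz_set_ge0 A : (0 <= frz_set e k p A)%E.
Proof.
apply: (big_ind (fun z => (0 <= z)%E)) => [|z w z0 w0|x _]; first exact: leey.
- by rewrite le_min z0.
- exact: frz_ge0.
Qed.

Lemma frz_set_gt A r : (forall x, x \in A -> (r%:E < frz e k p x)%E) ->
  (r%:E < frz_set e k p A)%E.
Proof.
move=> rA; rewrite /frz_set big_seq.
apply: (big_ind (fun z => (r%:E < z)%E)) => [|z w z0 w0|x /rA//].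
- exact: ltry.
- by rewrite lt_min z0.
Qed.

Lemma frz_gt x r : ((e * r)%:E < lambda k p x)%E ->
  (((1 + e) * r)%:E < frz e k p x)%E.
Proof.
have e1 : 0 < (1 + e) / e by rewrite divr_gt0// addr_gt0.
rewrite /frz; case: (lambda k p x) => [l| |]//; last first.
  by move=> _; rewrite gt0_muley ?lte_fin// ltry.
rewrite lte_fin -EFinM lte_fin => h.
have -> : (1 + e) * r = (1 + e) / e * (e * r) by field; rewrite gt_eqF.
by rewrite ltr_pM2l.
Qed.

Lemma ksubsetsP A :
  reflect ((A `<=` P)%fset /\ #|` A| = k) (A \in ksubsets P k).
Proof.
by rewrite !inE /= fpowersetE; apply: (iffP andP) => -[? /eqP].
Qed.

(* Let [i] be the first index beyond [k] whose insertion radius is at most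
   [e * r]: each point of [P] outside the prefix of length [i] has [k] points
   of the prefix within [e * r], and the points of the prefix freeze after
   [(1 + e) * r]. *)
Lemma lens_unfrozen A r x : A \in ksubsets P k -> 0 <= r -> lens r A x ->
  exists B, [/\ B \in ksubsets P k, (((1 + e) * r)%:E < frz_set e k p B)%E &
    lens ((1 + e) * r) B x].
Proof.
move=> /ksubsetsP[AP Ak] r0 xA; have [p_uniq pP p_max] := hp.
have [k0 kn] := andP kP.
have sp : size p = #|` P|.
  by apply/perm_size/uniq_perm => //; exact: fset_uniq.
have er0 : 0 <= e * r by rewrite mulr_ge0// ltW.
pose Q i := (k <= i < size p)%N &&
  (kdist k (nth 0 p i) (prefix_set p i) <= e * r).
have [i [ki ip i_min i_le]] : exists i, [/\ (k <= i)%N, (i <= size p)%N,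
    forall j, (k <= j < i)%N -> ~~ Q j & (i < size p)%N -> Q i].
  have [exQ|nQ] := pselect (exists i, Q i).
    case: (ex_minnP exQ) => i Qi iQ; exists i; split => //.
    - by have /andP[/andP[]] := Qi.
    - by have /andP[/andP[_ /ltnW]] := Qi.
    - by move=> j /andP[_ ji]; apply/negP => /iQ; rewrite leqNgt ji.
  (* Without such an index, the prefix is all of [P]. *)
  exists (size p); split=> [|//|j _|]; rewrite ?sp// ?ltnn//.
  by apply/negP => Qj; apply: nQ; exists j.
have in_prefix z : (z \in prefix_set p i) = (z \in take i p).
  by rewrite in_fset.
have card_prefix : #|` prefix_set p i| = i.
  by rewrite card_fseq undup_id ?take_uniq// size_takel.
have frz_prefix z : z \in prefix_set p i -> (((1 + e) * r)%:E < frz e k p z)%E.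
  rewrite in_prefix => zi; apply: frz_gt; rewrite /lambda.
  case: ifPn => [_|]; first exact: ltry.
  rewrite -leqNgt => kz; have zp := mem_take zi.
  have zi' : (index z p < i)%N.
    by move: zi; rewrite in_take.
  have := i_min (index z p); rewrite kz zi' => /(_ isT).
  by rewrite /Q kz index_mem zp /= nth_index// -ltNge lte_fin.
have [A_sub|] := boolP (A `<=` prefix_set p i)%fset.
  exists A; split.
  - exact/ksubsetsP.
  - by apply: frz_set_gt => z /(fsubsetP A_sub); exact: frz_prefix.
  - move=> a /xA; rewrite /eball/= => /le_trans; apply.
    by rewrite mulrDl mul1r lerDl.
move=> /fsubsetPn[q qA qi].
have qP : q \in P := fsubsetP AP _ qA.
have isp : (i < size p)%N.
  rewrite ltn_neqAle ip andbT; apply: contra qi => /eqP ->.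
  by rewrite in_fset take_size pP.
have qd : kdist k q (prefix_set p i) <= e * r.
  (* By the greedy choice, [kdist] to the prefix is at most as large at [q] as at the next point of
     [p]. *)
  apply: le_trans (p_max i _ q qP qi) _; first by rewrite ki.
  by have /andP[] := i_le isp.
(* All of [A] is replaced by [k] prefix points near the single centre [q], at the cost of [e * r] in
   the radius. *)
have [|B [Bi Bk Bq]] := kdist_subset _ qd; first by rewrite k0 card_prefix.
exists B; split.
- apply/ksubsetsP; split=> //; apply/fsubsetP => z /(fsubsetP Bi).
  by rewrite in_prefix => /mem_take; rewrite pP.
- by apply: frz_set_gt => z /(fsubsetP Bi); exact: frz_prefix.
- move=> b /Bq qb; apply: le_trans (edist_triangle q _ _) _.
  by rewrite mulrDl mul1r lerD//; exact: xA.
Qed.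

Lemma frozen_lens_unfrozen A alpha x : (alpha%:E < frz_set e k p A)%E ->
  frozen_lens e k p alpha A x = lens alpha A x.
Proof. by rewrite /frozen_lens => ->. Qed.

(** Truncation at [r] makes a possibly infinite freezing time finite without affecting frozen lenses
    at scales up to [r]. *)
Definition frozen_radius r A : R := fine (Order.min r%:E (frz_set e k p A)).

Lemma frozen_lensP r A alpha x : 0 <= alpha <= r ->
  frozen_lens e k p alpha A x <->
  alpha <= (1 + e) * frozen_radius r A /\
  lens (Num.min alpha (frozen_radius r A)) A x.
Proof.
move=> /andP[a0 ar]; have r0 := le_trans a0 ar.
have le_1e t : 0 <= t -> t <= (1 + e) * t.
  by move=> t0; rewrite mulrDl mul1r lerDl mulr_ge0// ltW.
rewrite /frozen_lens /frozen_radius; have := frz_set_ge0 A.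
case: (frz_set e k p A) => [f| |]//; last first.
  move=> _; rewrite ltry (min_idPl _) ?leey//= (min_idPl ar).
  by split=> [xA|[]//]; split=> //; apply: le_trans ar _; exact: le_1e.
rewrite !lte_fin -EFinM !lee_fin -EFin_min/= => f0.
have m0 : 0 <= Num.min r f by rewrite le_min r0.
have [af|fa] := ltP alpha f.
  have am : alpha <= Num.min r f by rewrite le_min ar ltW.
  rewrite (min_idPl am); split=> [xA|[]//]; split=> //.
  by apply: le_trans am _; exact: le_1e.
rewrite (min_idPr (le_trans fa ar)) (min_idPr fa).
by case: ifPn => // /negP aF; split=> // -[].
Qed.

(** * The cones as convex zero sets of a continuous function *)

Local Notation V := (ksubsets P k).
Local Notation cones r := (fun A : V => cone e k p r (val A)).

(** The total violation of the inequalities in [frozen_lensP]; it serves as the function [G] of the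
    nerve theorem. *)
Definition gap r A y : R :=
  \sum_(a <- A) Num.max 0 (edist y.1 a - Num.min y.2 (frozen_radius r A)) +
  Num.max 0 (y.2 - (1 + e) * frozen_radius r A).

Lemma gap_ge0 r A y : 0 <= gap r A y.
Proof.
by rewrite addr_ge0 ?le_max ?lexx// sumr_ge0// => a _; rewrite le_max lexx.
Qed.

Lemma pospart_eq0 (t : R) : (Num.max 0 t == 0) = (t <= 0).
Proof. by rewrite eq_maxl. Qed.

Lemma gap_eq0 r A y : 0 <= y.2 <= r -> gap r A y = 0 <-> cone e k p r A y.
Proof.
move=> y2; have yP := frozen_lensP A y.1 y2.
rewrite /cone/=; split=> [/eqP|[_ /yP[yF yA]]].
  rewrite paddr_eq0 ?le_max ?lexx ?sumr_ge0//; last first.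
    by move=> a _; rewrite le_max lexx.
  rewrite pospart_eq0 subr_le0 psumr_eq0; last first.
    by move=> a _; rewrite le_max lexx.
  move=> /andP[/allP yA yF]; split=> //; apply/yP; split=> // a aA.
  by have /= := yA a aA; rewrite pospart_eq0 subr_le0.
rewrite /gap big_seq big1 => [|a aA].
  by rewrite add0r; apply/eqP; rewrite pospart_eq0 subr_le0.
by apply/eqP; rewrite pospart_eq0 subr_le0; exact: yA.
Qed.

Lemma continuous_gap r A : continuous (gap r A).
Proof.
apply: continuous_add.
  apply: continuous_sum => a; apply: continuous_pospart; apply: continuous_sub.
    exact: (continuous_of_comp (@continuous_edist _ _ a) (@continuous_fst _ _)).
  move=> y; apply: (@continuous_min _ _ snd (fun=> frozen_radius r A)).
    exact: continuous_snd.
  exact: continuous_cst.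
apply: continuous_pospart; apply: continuous_sub; first exact: continuous_snd.
exact: continuous_cst.
Qed.

(** The distance to a centre is convex, while the allowed radius, a minimum of the height and a
    constant, is concave in the height. *)
Lemma cone_convex r A : segment_closed (cone e k p r A : set (E * R^o)).
Proof.
move=> s y z /andP[s0 s1] [y2 yA] [z2 zA].
have [y20 y2r] := andP y2; have [z20 z2r] := andP z2.
have r0 : 0 <= r by apply: le_trans y2r.
have s1' : 0 <= 1 - s by rewrite subr_ge0.
set F := frozen_radius r A.
have yz2 : 0 <= s * y.2 + (1 - s) * z.2 <= r by nra.
split=> //; apply/(frozen_lensP _ _ yz2).
have [yF yB] := (frozen_lensP _ _ y2).1 yA.
have [zF zB] := (frozen_lensP _ _ z2).1 zA.
split; first by rewrite -/F in yF zF *; nra.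
move=> a aA; apply: le_trans (edist_convex _ _ _ _) _; first exact/andP.
have := yB a aA; have := zB a aA; rewrite /eball/= !le_min -/F.
move=> /andP[za zf] /andP[ya yf]; apply/andP; split.
  by apply: lerD; apply: ler_wpM2l.
rewrite [leRHS](_ : F = s * F + (1 - s) * F); last by ring.
by apply: lerD; apply: ler_wpM2l.
Qed.

(** If the lens of [A] survives at [beta], it still contains [x]. Otherwise [x] lies in the lens of
    radius [beta / (1 + e)], and [lens_unfrozen] gives one that is not yet frozen at [beta]. *)
Lemma cone_up r A x (alpha beta : R) : A \in V -> alpha <= beta <= r ->
  cone e k p r A (x, alpha) -> exists2 B, B \in V & cone e k p r B (x, beta).
Proof.
move=> AV /andP[ab br] [/= ar xA].
have [a0 _] := andP ar; have b0 := le_trans a0 ab.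
have r0 := le_trans b0 br.
have bitv : 0 <= beta <= r by rewrite b0.
have [aF xF] := (frozen_lensP A x ar).1 xA.
have [bF|Fb] := leP beta ((1 + e) * frozen_radius r A).
  exists A => //; split => //; apply/(frozen_lensP A x bitv); split=> //.
  move=> a /xF; rewrite /eball/= !le_min => /andP[xa ->].
  by rewrite (le_trans xa).
have e1 : 0 < 1 + e by rewrite addr_gt0.
have xb : lens (beta / (1 + e)) A x.
  move=> a /xF; rewrite /eball/= le_min => /andP[_ /le_trans]; apply.
  by rewrite ler_pdivlMr// mulrC ltW.
have [|B [BV Bb xB]] := lens_unfrozen AV _ xb.
  by rewrite divr_ge0// ltW.
have bE : (1 + e) * (beta / (1 + e)) = beta by rewrite mulrC divfK// gt_eqF.
rewrite bE in Bb xB.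
by exists B => //; split=> //; rewrite frozen_lens_unfrozen.
Qed.

(** * Compactness: base points and uniform neighbourhoods *)

Lemma ksubset_ex A : A \in V -> exists a, a \in A.
Proof.
move=> /ksubsetsP[_ Ak]; apply/fset0Pn; rewrite -cardfs_gt0 Ak.
by case/andP: kP.
Qed.

Lemma compact_cylinder a (rho r : R) :
  compact (eball a rho `*` `[0, r] : set (E * R^o)).
Proof.
by apply: compact_setX; [exact: compact_eball|exact: segment_compact].
Qed.

Lemma total_gap_eq0 r (s : {set V}) y : 0 <= y.2 <= r ->
  \sum_(A in s) gap r (val A) y = 0 <->
  (\bigcap_(A in [set` s]) cones r A) y.
Proof.
move=> yr; split=> [s0 A As|sy].
  apply/(gap_eq0 _ yr).
  by apply: (psumr_eq0P _ s0) => // B _; exact: gap_ge0.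
by apply: big1 => A As; apply/(gap_eq0 _ yr); exact: sy.
Qed.

Lemma continuous_total_gap r (s : {set V}) :
  continuous (fun y => \sum_(A in s) gap r (val A) y).
Proof. by apply: continuous_sum => A; exact: continuous_gap. Qed.

(* A point of lowest height works for all scales at once. *)
Lemma ex_base_point (s : {set V}) : exists b : E * R^o, forall r,
  simplex (nerve (cones r)) s ->
  forall A : V, A \in s -> cone e k p r (val A) b.
Proof.
have [[r [s0 [y sy]]]|ns] := pselect (exists r, simplex (nerve (cones r)) s);
  last first.
  (* Sets that are never simplices receive an arbitrary point. *)
  by exists (0, 0) => r sr; exfalso; apply: ns; exists r.
have [A0 A0s] := finset.set0Pn _ s0; have [a aA0] := ksubset_ex (valP A0).
have [yr _] := sy A0 A0s.
pose H y := \sum_(A in s) gap r (val A) y.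
pose K : set (E * R^o) :=
  (eball a r `*` `[0, r]) `&` (H @^-1` [set t | t <= 0]).
have KP z : K z <-> 0 <= z.2 <= r /\ (\bigcap_(A in [set` s]) cones r A) z.
  split=> [[[_]]|[zr zs]].
    rewrite /= in_itv/= => zr Hz; split=> //; apply/(total_gap_eq0 _ zr)/eqP.
    by rewrite eq_le Hz sumr_ge0// => A _; exact: gap_ge0.
  split; last by rewrite /preimage/= /H (total_gap_eq0 _ zr).2.
  split; last by rewrite /= in_itv.
  have [_ zA0] := zs A0 A0s.
  have [_ /(_ a aA0)] := (frozen_lensP _ _ zr).1 zA0.
  rewrite /eball/= le_min => /andP[za _]; apply: le_trans za _.
  by case/andP: zr.
have cK : compact K.
  apply: compact_closedI; first exact: compact_cylinder.
  apply: closed_comp => [z _|]; last exact: closed_le.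
  exact: continuous_total_gap.
have K0 : K !=set0 by exists y; apply/KP.
have c2 : {within K, continuous (@snd E R^o)}.
  by apply: continuous_subspaceT; exact: continuous_snd.
have [b bK b_min] := compact_EVT_min K0 cK c2.
have [br bs] := (KP b).1 (set_mem bK).
(* Membership in a cone depends on the scale only through the height bound, so it remains to show
   [b.2 <= r']. *)
exists b => r' [_ [z zs]] A As.
have [/andP[z0 zr'] _] := zs A0 A0s.
have [_ bA] := bs A As; split=> //.
have [b0 br'] := andP br; rewrite b0 /=.
have [zr|rz] := leP z.2 r; last first.
  exact: le_trans br' (ltW (lt_le_trans rz zr')).
have : b.2 <= z.2.
  apply: b_min; apply/mem_set/KP; split; first by rewrite z0.
  move=> B Bs; have [_ zB] := zs B Bs; split=> //; rewrite z0//.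
by move=> /le_trans; apply.
Qed.

(** On a compact cylinder the total gap has a positive minimum, a fixed share of which falls to some
    [A]; outside the ball of radius [r + 1] the gap of a lens with centre [a] exceeds 1. *)
Lemma ex_nerve_gap r (s : {set V}) : 0 <= r -> s != finset.set0 ->
  ~ simplex (nerve (cones r)) s -> exists2 delta : R, 0 < delta &
  forall y, 0 <= y.2 <= r -> exists2 A : V, A \in s & delta <= gap r (val A) y.
Proof.
move=> r0 s0 ns.
have [A0 A0s] := finset.set0Pn _ s0; have [a aA0] := ksubset_ex (valP A0).
pose H y := \sum_(A in s) gap r (val A) y.
pose K : set (E * R^o) := eball a (r + 1) `*` `[0, r].
have K0 : K !=set0.
  exists (a, 0); split; last by rewrite /= in_itv/= lexx.
  by rewrite /eball/= edist_xx addr_ge0.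
have cH : {within K, continuous H}.
  by apply: continuous_subspaceT; exact: continuous_total_gap.
have [c /set_mem[_ cr] c_min] :=
  compact_EVT_min K0 (@compact_cylinder _ _ _) cH.
rewrite /= in_itv/= in cr.
have Hc : 0 < H c.
  rewrite lt_def sumr_ge0 ?andbT; last by move=> A _; exact: gap_ge0.
  by apply/eqP => /(total_gap_eq0 _ cr) sc; apply: ns; split=> //; exists c.
(* The extra 1 makes [#|s|] shares of [H c / n] sum to less than [H c]. *)
pose n : R := #|s|%:R + 1.
have n0 : 0 < n by rewrite ltr_wpDl.
exists (Num.min 1 (H c / n)); first by rewrite lt_min ltr01 divr_gt0.
move=> y yr; have [ya|ya] := leP (edist y.1 a) (r + 1); last first.
  exists A0 => //; rewrite ge_min; apply/orP; left; apply: ltW.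
  apply: lt_le_trans (_ : edist y.1 a - r <= _); first by rewrite ltrBrDl.
  rewrite /gap (big_rem a)//= -addrA; apply: ler_wpDr.
    rewrite addr_ge0 ?le_max ?lexx// sumr_ge0// => z _.
    by rewrite le_max lexx.
  rewrite le_max; apply/orP; right; rewrite lerD2l lerN2 ge_min.
  by case/andP: yr => _ ->.
apply: contrapT => nA.
have : H c <= H y.
  by apply: c_min; apply/mem_set; split=> //=; rewrite in_itv.
apply/negP; rewrite -ltNge; apply: (@le_lt_trans _ _ (\sum_(A in s) (H c / n))).
  apply: ler_sum => A As; rewrite leNgt; apply/negP => h; apply: nA.
  by exists A => //; rewrite ge_min (ltW h) orbT.
rewrite sumr_const -mulr_natr -mulrA gtr_pMr// mulrC ltr_pdivrMr// mul1r.
by rewrite ltrDl.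
Qed.

(** There are finitely many sets [s], so the bounds for the non-simplices have a positive minimum, a
    kind of Lebesgue number of the cones. *)
Lemma ex_nerve_gaps r : 0 <= r -> exists2 delta : R, 0 < delta &
  forall (s : {set V}) y, 0 <= y.2 <= r -> s != finset.set0 ->
  (forall A : V, A \in s -> gap r (val A) y < delta) ->
  simplex (nerve (cones r)) s.
Proof.
move=> r0.
have /choice[D DP] (s : {set V}) : exists delta : R, 0 < delta /\
    (s != finset.set0 -> ~ simplex (nerve (cones r)) s ->
    forall y, 0 <= y.2 <= r ->
    exists2 A : V, A \in s & delta <= gap r (val A) y).
  have [[s0 ns]|h] :=
    pselect (s != finset.set0 /\ ~ simplex (nerve (cones r)) s).
    by have [D D0 DP] := ex_nerve_gap r0 s0 ns; exists D.
  by exists 1; split=> // s0 ns; exfalso; exact: h.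
exists (\big[Num.min/1]_s D s).
  by apply: lt_bigmin => // s _; have [] := DP s.
move=> s y yr s0 sy; apply: contrapT => ns.
have [A As] := (DP s).2 s0 ns y yr.
apply/negP; rewrite -ltNge; apply: lt_le_trans (sy A As) _.
exact: bigmin_le_cond.
Qed.

Definition sparse_cover r : set E :=
  \bigcup_(A in [set` V]) frozen_lens e k p r A.

Lemma sparse_coverP r x : 0 <= r ->
  sparse_cover r x <-> (\bigcup_A cones r A) (x, r).
Proof.
move=> r0; split=> [[A AV xA]|[A _ [_ xA]]]; last first.
  by exists (val A) => //; exact: valP.
by exists (Sub A AV : V) => //; split; rewrite /= ?r0 ?lexx.
Qed.

(** A lens that has vanished by scale [s] is replaced by another through [cone_up]. *)
Lemma sparse_cover_mono r (s : R) : 0 <= r <= s ->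
  sparse_cover r `<=` sparse_cover s.
Proof.
move=> /andP[r0 rs] x [A AV xA].
have rss : r <= s <= s by rewrite rs lexx.
have xC : cone e k p s A (x, r) by split; rewrite //= r0 rs.
by have [B BV [_ xB]] := cone_up AV rss xC; exists B.
Qed.

Lemma sparse_cover_sub r : 0 <= r -> sparse_cover r `<=` kfold_cover P k r.
Proof.
move=> r0 x [A AV xA]; exists A => // a aA.
have rr : 0 <= r <= r by rewrite r0 lexx.
have [_ /(_ a aA)] := (frozen_lensP A x rr).1 xA.
by rewrite /eball/= le_min => /andP[].
Qed.

(** The lens supplied by [lens_unfrozen] still has its full size at [(1 + e) * r]. *)
Lemma kfold_cover_sub r : 0 <= r ->
  kfold_cover P k r `<=` sparse_cover ((1 + e) * r).
Proof.
move=> r0 x [A AV xA]; have [B [BV Br xB]] := lens_unfrozen AV r0 xA.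
by exists B => //; rewrite frozen_lens_unfrozen.
Qed.

Section base_points.
Variables (b : {set V} -> E * R^o) (r : R).
Hypothesis r0 : 0 <= r.
Hypothesis b_in : forall (s : {set V}) (A : V),
  simplex (nerve (cones r)) s -> A \in s -> cone e k p r (val A) (b s).

Let cones_up y (w : R) : 0 <= w <= 1 -> (\bigcup_A cones r A) y ->
  (\bigcup_A cones r A) (y.1, (1 - w) * y.2 + w * r).
Proof.
move=> /andP[w0 w1] [A _ yA]; have [/andP[_ yr] _] := yA.
have yE : y = (y.1, y.2) by case: (y).
rewrite yE in yA.
have [|B BV yB] := @cone_up r _ _ _ ((1 - w) * y.2 + w * r) (valP A) _ yA.
  by apply/andP; split; nra.
by exists (Sub B BV : V).
Qed.

Let gap_cone (A : V) y : (\bigcup_A cones r A) y ->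
  gap r (val A) y = 0 <-> cone e k p r (val A) y.
Proof. by move=> [B _ [yr _]]; exact: gap_eq0. Qed.

Lemma flag_average_sparse_cover (t : realization R (nerve (cones r))) :
  sparse_cover r (flag_average b (\val t)).1.
Proof.
have [delta d0 dP] := ex_nerve_gaps r0.
apply: (nerve_projection_maps (C := cones r) (r := r)) => //.
- by move=> A; exact: cone_convex.
- by move=> x; exact: sparse_coverP.
Qed.

Lemma sparse_nerve_equivalence
    (f : realization R (nerve (cones r)) -> sparse_cover r) :
  (forall t, \val (f t) = (flag_average b (\val t)).1) ->
  homotopy_equivalence R f.
Proof.
have [delta d0 dP] := ex_nerve_gaps r0.
move=> fE; refine (@nerve_projection_equivalence R E V (cones r) r delta
  (fun A : V => gap r (val A)) b (sparse_cover r) _ _ _ _ _ _ _ _ _ f fE) => //.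
- by move=> A; exact: cone_convex.
- by move=> x; exact: sparse_coverP.
- by move=> A; exact: continuous_gap.
- by move=> A y; exact: gap_ge0.
- by move=> s y [A _ [yr _]]; exact: dP.
Qed.

End base_points.

End sparse_lenses.

(** * Discrete scales and the interleaving *)

Lemma discrete_scale_ge0 (R : realType) (eps r : R) : 0 < eps -> 0 <= r ->
  0 <= discrete_scale eps r.
Proof.
move=> e0; rewrite le_eqVlt => /orP[/eqP <-|r0].
  by rewrite /discrete_scale ltxx.
have [z -> _] := discrete_scaleP e0 r0.
by rewrite exprz_ge0// addr_ge0// divr_ge0// ltW.
Qed.

Lemma discrete_scale_le (R : realType) (eps r : R) : 0 < eps -> 0 <= r ->
  discrete_scale eps r <= r.
Proof.
move=> e0; rewrite le_eqVlt => /orP[/eqP <-|r0].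
  by rewrite /discrete_scale ltxx.
by have [z -> /andP[]] := discrete_scaleP e0 r0.
Qed.

Lemma discrete_scale_ge (R : realType) (eps r : R) : 0 < eps -> 0 <= r ->
  r <= (1 + eps / 3) * discrete_scale eps r.
Proof.
move=> e0; rewrite le_eqVlt => /orP[/eqP <-|r0].
  by rewrite /discrete_scale ltxx mulr0.
have c0 : 0 < 1 + eps / 3 by rewrite addr_gt0// divr_gt0.
have [z -> /andP[_ /ltW]] := discrete_scaleP e0 r0.
by rewrite expfzDr ?gt_eqF// expr1z [leRHS]mulrC.
Qed.

Theorem theorem10 (R : realType) (d k : nat) (P : {fset 'rV[R]_d})
  (p : seq 'rV[R]_d) (eps : R) (eps0 : 0 < eps) (eps1 : eps <= 1)
  (hk : (1 <= k <= #|` P|)%N) (hp : kdistance_permutation P k p) :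
  homotopy_interleaved (1 + eps)
    (discrete_sparse_cech_filtration eps0 P k p) (kfold_filtration P k).
Proof.
have e0 : 0 < eps / 3 by rewrite divr_gt0.
pose T (r : R) := sparse_cover (eps / 3) k P p (discrete_scale eps r).
have T_mono (r s : R) : 0 <= r <= s -> T r `<=` T s.
  move=> rs; apply: (sparse_cover_mono e0 hk hp).
  rewrite discrete_scale_mono// andbT discrete_scale_ge0//.
  by case/andP: rs.
have T_sub (r : R) : 0 <= r -> T r `<=` kfold_cover P k ((1 + eps) * r).
  move=> r0; apply: (subset_trans (sparse_cover_sub e0 _)).
    exact: discrete_scale_ge0.
  apply: kfold_cover_mono; rewrite discrete_scale_ge0//=.
  apply: le_trans (discrete_scale_le eps0 r0) _.
  by rewrite mulrDl mul1r lerDl mulr_ge0// ltW.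
have sub_T (r : R) : 0 <= r -> kfold_cover P k r `<=` T ((1 + eps) * r).
  move=> r0; apply: (subset_trans (kfold_cover_sub e0 hk hp r0)).
  apply: (sparse_cover_mono e0 hk hp).
  have cr0 : 0 <= (1 + eps) * r by rewrite mulr_ge0// addr_ge0// ltW.
  rewrite mulr_ge0 ?addr_ge0 ?(ltW e0)//=.
  have c0 : 0 < 1 + eps / 3 by rewrite addr_gt0.
  rewrite -(ler_pM2l c0); apply: le_trans (discrete_scale_ge eps0 cr0).
  (* One factor [1 + eps / 3] comes from freezing and one from rounding;
     [(1 + eps / 3) ^+ 2 <= 1 + eps] holds because [eps <= 1]. *)
  by rewrite mulrA; apply: ler_wpM2r => //; nra.
(* The base points are chosen once for all scales, so the projections commute with the
   inclusions. *)
have [b bP] := choice (ex_base_point p e0 hk).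
exists (subspace_filtration T_mono), (kfold_filtration P k); split.
(* The equivalence runs from the sparse complexes to the unions of frozen lenses. *)
- right.
  have fP (r : R) (r0 : 0 <= r)
      (t : realization R (discrete_sparse_cech eps P k p r)) :
      T r (flag_average b (\val t)).1.
    apply: (flag_average_sparse_cover e0 hk hp (discrete_scale_ge0 eps0 r0)).
    by move=> s A /bP; apply.
  exists (fun r r0 t => exist _ (flag_average b (\val t)).1
    (mem_set (fP r r0 t)) : T r); split.
    move=> r r0.
    apply: (sparse_nerve_equivalence e0 hk hp (discrete_scale_ge0 eps0 r0)
      (b := b)) => //.
    by move=> s A /bP; apply.
  by move=> r s rs r0 s0 t; exact: val_inj.
- left; exists (fun r r0 => idfun); split=> // r r0; split.
    by move=> x; exact: cvg_id.
  exists idfun; split.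
  + by move=> x; exact: cvg_id.
  + by apply: homotopic_refl => x; exact: cvg_id.
  + by apply: homotopic_refl => x; exact: cvg_id.
split; first by rewrite lerDl ltW.
(* Both interleaving maps are inclusions in the ambient space. *)
exists (fun r r0 x =>
  exist _ (\val x) (mem_set (T_sub r r0 _ (set_mem (valP x))))).
exists (fun r r0 x =>
  exist _ (\val x) (mem_set (sub_T r r0 _ (set_mem (valP x))))).
split.
- by move=> r r0; apply: continuous_set_type; exact: continuous_set_val.
- by move=> r r0; apply: continuous_set_type; exact: continuous_set_val.
- by move=> r r0 cr0 rccr x; exact: val_inj.
- by move=> r r0 cr0 rccr x; exact: val_inj.
Qed.
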